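(* Let $G$ be a finite simple undirected graph of order $n$ with fewer than $\frac{11}{5}n-\frac{18}{5}$ edges. Then $G$ has a forest cut.
   Context: A vertex cut of a graph $G$ is a set $S\subseteq V(G)$ such that $G-S$ is disconnected. A forest cut of $G$ is a vertex cut $S$ such that the induced subgraph $G[S]$ is a forest (acyclic). *)

(* Defs.v *)
From mathcomp Require Import all_boot all_order all_algebra.
Set Implicit Arguments.
Unset Strict Implicit.
Unset Printing Implicit Defensive.

(* A finite simple undirected graph is a symmetric irreflexive relation
   [e : rel T] on a finite vertex type [T]. *)

Definition edges (T : finType) (e : rel T) : {set {set T}} :=
  [set [set p.1; p.2] | p : T * T & e p.1 p.2].

Definition induced (T : finType) (e : rel T) (A : {set T}) :
    rel {x : T | x \in A} :=
  [rel x y | e (val x) (val y)].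
Arguments induced {T} e A.

(* The graph with no vertex is not disconnected. *)
Definition disconnected (T : finType) (e : rel T) : Prop :=
  exists x y : T, ~~ connect e x y.

(* A two-element [ucycle] is an edge traversed back and forth, hence the
   bound on the length. *)
Definition acyclic (T : finType) (e : rel T) : Prop :=
  forall c : seq T, 2 < size c -> ~ ucycle e c.

Definition vertex_cut (T : finType) (e : rel T) (S : {set T}) : Prop :=
  disconnected (induced e (~: S)).

Definition forest_cut (T : finType) (e : rel T) (S : {set T}) : Prop :=
  vertex_cut e S /\ acyclic (induced e S).

(* Main.v *)
(** In a counterexample of minimum order every neighbourhood [N(u)] with
    [N[u] <> V] contains a cycle.  A vertex of degree 3 would have a clique as
    neighbourhood and could be deleted, so all degrees are at least 4.  Let [u]
    have degree 4.  If [N(u)] contains a 4-cycle, delete [u] and add a missing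
    diagonal of the cycle.  So [N(u)] contains a triangle.  No vertex [v] of this
    triangle has degree 4: otherwise the neighbourhood of [{u, v}] is a forest
    cut, or deleting [u] and [v] and adding two edges gives a smaller
    counterexample.  Hence a vertex of degree 4 has at most one neighbour of
    degree 4, and therefore the neighbourhood of a vertex of degree 5, which
    contains a cycle, does not consist of vertices of degree 4 only.  Discharging
    then gives average degree at least 22/5, a contradiction. *)

Require Import Defs.
From mathcomp Require Import all_boot all_order all_algebra.
From mathcomp Require Import zify lra.

Set Implicit Arguments.
Unset Strict Implicit.
Unset Printing Implicit Defensive.

Import GRing.Theory Num.Theory.

Section ForestCuts.

Variable T : finType.
Implicit Types (e : rel T) (V S X W : {set T}) (f : T -> option bool).

(** * Encoding of neighbourhoods, forests, separations and added edges *)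

Definition nbr e V x : {set T} := [set y in V | e x y].

(* Acyclicity in the form of 1-degeneracy. *)
Definition forest e S : bool :=
  [forall X : {set T}, (X \subset S) ==> (X != set0) ==>
    [exists x in X, #|nbr e X x| <= 1]].

(* A separation of [V] is a colouring: [Some true] and [Some false] are the two
   sides, [None] is the cut. *)
Definition cut_part V f : {set T} := [set x in V | f x == None].

Definition compat (o1 o2 : option bool) : bool :=
  if (o1, o2) is (Some b1, Some b2) then b1 == b2 else true.

Definition fcut e V f : Prop :=
  [/\ forall b, exists2 x, x \in V & f x = Some b,
      forall x y, x \in V -> y \in V -> e x y -> compat (f x) (f y)
    & forest e (cut_part V f)].

(* Twice the number of edges of the graph induced on [V]. *)
Definition arcs e V : nat := \sum_(x in V) #|nbr e V x|.

(* The graph is left unchanged when [a = b]. *)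
Definition add_edge a b e : rel T := fun x y => e x y ||
  (a != b) && ((x == a) && (y == b) || (x == b) && (y == a)).

Definition recolor f u o : T -> option bool :=
  fun x => if x == u then o else f x.

Lemma add_edge_sym a b e : symmetric e -> symmetric (add_edge a b e).
Proof.
move=> sym x y; rewrite /add_edge sym; congr (_ || (_ && _)).
by rewrite orbC; congr (_ || _); rewrite andbC.
Qed.

Lemma add_edge_irr a b e : irreflexive e -> irreflexive (add_edge a b e).
Proof.
move=> irr x; rewrite /add_edge irr /=; case: (eqVneq a b) => //= ab.
by case: eqP => [->|_] /=; rewrite ?(negPf ab) ?andbF.
Qed.

Lemma sub_add_edge a b e : subrel e (add_edge a b e).
Proof. by move=> x y exy; rewrite /add_edge exy. Qed.

Lemma add_edge_new a b e : a != b -> add_edge a b e a b.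
Proof. by move=> ab; rewrite /add_edge ab !eqxx orbT. Qed.

Lemma in_nbr e V x y : (y \in nbr e V x) = (y \in V) && e x y.
Proof. by rewrite inE. Qed.

Lemma nbr_mono e e' V W x :
  V \subset W -> {in V & V, subrel e e'} -> x \in V ->
  nbr e V x \subset nbr e' W x.
Proof.
move=> sVW see xV; apply/subsetP => y; rewrite !in_nbr => /andP[yV exy].
by rewrite (subsetP sVW) //= see.
Qed.

(** * Forests as 1-degenerate graphs *)

Lemma forestP e S :
  reflect (forall X, X \subset S -> X != set0 ->
             exists2 x, x \in X & #|nbr e X x| <= 1) (forest e S).
Proof.
apply: (iffP forallP) => [h X sX nX | h X].
  by move: (h X); rewrite sX nX /= => /exists_inP.
by apply/implyP => sX; apply/implyP => nX; apply/exists_inP; apply: h.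
Qed.

Lemma forestPn e S : ~~ forest e S ->
  exists X, [/\ X \subset S, X != set0
              & forall x, x \in X -> 1 < #|nbr e X x|].
Proof.
rewrite negb_forall => /existsP[X]; rewrite 2!negb_imply => /and3P[sX nX hX].
exists X; split=> // x xX; rewrite ltnNge; apply/negP => hx.
by case/negP: hX; apply/exists_inP; exists x.
Qed.

Lemma forest_sub e e' S : {in S & S, subrel e e'} -> forest e' S -> forest e S.
Proof.
move=> see /forestP h; apply/forestP => X sX nX.
have [x xX hx] := h X sX nX; exists x => //; apply: leq_trans hx.
apply: subset_leq_card; apply: nbr_mono => // y z yX zX.
by apply: see; apply: (subsetP sX).
Qed.

Lemma forestU1 e S u :
  irreflexive e -> forest e S -> #|nbr e S u| <= 1 -> forest e (u |: S).
Proof.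
move=> irr /forestP h hu; apply/forestP => X sX nX.
have [uX|nuX] := boolP (u \in X).
  exists u => //; apply: leq_trans hu; apply: subset_leq_card.
  apply/subsetP => y; rewrite !in_nbr => /andP[yX euy].
  move/subsetP/(_ y yX): sX; rewrite !inE euy andbT => /orP[/eqP yu|//].
  by rewrite yu irr in euy.
apply: h => //; apply/subsetP => y yX.
by move/subsetP/(_ y yX): sX; rewrite !inE => /orP[/eqP yu|//]; rewrite -yu yX in nuX.
Qed.

Lemma forest0 e : forest e set0.
Proof. by apply/forestP => X; rewrite subset0 => ->. Qed.

Lemma forest_card2 e S : irreflexive e -> #|S| <= 2 -> forest e S.
Proof.
move=> irr S2; apply/forestP => X sX /set0Pn[x xX]; exists x => //.
suff sub : nbr e X x \subset X :\ x.
  have := subset_leq_card sub; have := subset_leq_card sX.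
  by rewrite (cardsD1 x X) xX; lia.
apply/subsetP => y; rewrite !inE => /andP[-> exy]; rewrite andbT.
by apply: contraTneq exy => ->; rewrite irr.
Qed.

(** The new forest replaces the edge [ac] by the path through [u]. In a test set containing [u], [a]
    and [c], a vertex of degree at most 1 found after removing [u] still works: at [a] or [c] the
    edge [ac] is traded for the edge to [u], and no other vertex is adjacent to [u]. If [a] or [c]
    is missing from the test set, [u] itself works. *)
Lemma forest_subdivide e S u a c :
  symmetric e -> irreflexive e -> a != u -> c != u -> a != c -> ~~ e a c ->
  forest (add_edge a c e) S -> nbr e S u \subset [set a; c] ->
  forest e (u |: S).
Proof.
move=> sym irr au cu ac eac fS sN; apply/forestP => X sX nX.
have sX' y : y \in X -> y != u -> y \in S.
  by move=> yX yu; move/subsetP/(_ y yX): sX; rewrite !inE (negPf yu).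
have [uX|nuX] := boolP (u \in X); last first.
  have /forestP h := forest_sub (in2W (@sub_add_edge a c e)) fS.
  apply: h => //; apply/subsetP => y yX; apply: sX' => //.
  by apply: contraNneq nuX => <-.
have uN y : y \in X -> e u y -> y \in [set a; c].
  move=> yX euy; apply: (subsetP sN); rewrite in_nbr euy sX' //.
  by apply: contraTneq euy => ->; rewrite irr.
have [/andP[aX cX]|nac] := boolP ((a \in X) && (c \in X)); last first.
  exists u => //.
  suff [z sz] : exists z, nbr e X u \subset [set z].
    by rewrite -(cards1 z); apply: subset_leq_card.
  have [aX|naX] := boolP (a \in X).
    exists a; apply/subsetP => y; rewrite in_nbr => /andP[yX /(uN y yX)].
    rewrite !inE => /orP[//|/eqP yc]; by rewrite aX -yc yX in nac.
  exists c; apply/subsetP => y; rewrite in_nbr => /andP[yX /(uN y yX)].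
  rewrite !inE => /orP[/eqP ya|//]; by rewrite -ya yX in naX.
have sXu : X :\ u \subset S.
  by apply/subsetP => y; rewrite !inE => /andP[yu yX]; apply: sX'.
have nXu : X :\ u != set0 by apply/set0Pn; exists a; rewrite !inE au.
have /forestP h := fS.
have [x] := h _ sXu nXu; rewrite !inE => /andP[xu xX] hx; exists x => //.
(* Here [p] and [q] are [a] and [c] in either order. The added edge already uses up the single
   neighbour allowed to [p], so only [u] can be a neighbour of [p] in [e]. *)
have other p q : (x == p) -> p != q -> q \in X -> q != u -> ~~ e p q ->
    add_edge a c e p q -> #|nbr e X x| <= 1.
  move=> /eqP xp pq qX qu epq apq; rewrite -(cards1 u).
  apply: subset_leq_card; apply/subsetP => y; rewrite in_nbr inE => /andP[yX exy].
  apply: contraLR hx => yu; rewrite -ltnNge; apply/card_gt1P; exists y, q.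
  split; rewrite ?in_nbr ?in_setD1 ?qu ?yu ?qX ?yX //=; last first.
    by apply: contraNneq epq => <-; rewrite -xp.
    by rewrite xp; exact: apq.
  by rewrite /add_edge exy.
have [xa|xa] := boolP (x == a).
  by apply: (other a c) => //; apply: add_edge_new.
have [xc|xc] := boolP (x == c).
  apply: (other c a) => //; rewrite 1?eq_sym // 1?sym //.
  by rewrite add_edge_sym // add_edge_new.
apply: leq_trans hx; apply: subset_leq_card; apply/subsetP => y.
rewrite !inE => /andP[yX exy]; rewrite yX /add_edge exy !andbT.
apply: contraTneq exy => ->; rewrite sym; apply/negP => /(uN x xX).
by rewrite !inE (negPf xa) (negPf xc).
Qed.

(** * Separations whose cut is a forest *)

Lemma compatC : commutative compat.
Proof. by case=> [[]|] [[]|]. Qed.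

Lemma fcut_sub e e' V f : {in V & V, subrel e e'} -> fcut e' V f -> fcut e V f.
Proof.
move=> see [hf hE hS]; split=> //.
  by move=> x y xV yV /(see x y xV yV); apply: hE.
apply: forest_sub hS => x y; rewrite !inE => /andP[xV _] /andP[yV _].
exact: see.
Qed.

(** This lemma and the next put a deleted vertex back, on a side or into the cut. *)
Lemma fcut_recolor_side e V f u b :
  symmetric e -> irreflexive e -> u \in V -> fcut e (V :\ u) f ->
  (forall y, y \in V -> e u y -> compat (Some b) (f y)) ->
  fcut e V (recolor f u (Some b)).
Proof.
move=> sym irr uV [hf hE hS] hu; split.
- move=> b'; have [x] := hf b'; rewrite !inE => /andP[xu xV] fx.
  by exists x => //; rewrite /recolor (negPf xu).
- move=> x y xV yV exy; rewrite /recolor.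
  case: (eqVneq x u) => [xu|xu]; case: (eqVneq y u) => [yu|yu].
  + by rewrite xu yu irr in exy.
  + by apply: hu; rewrite -?xu.
  + by rewrite compatC; apply: hu => //; rewrite -yu sym.
  + by apply: hE; rewrite ?inE ?xu ?yu.
- congr (forest e _): hS; apply/setP => x; rewrite !inE /recolor.
  by case: eqP => //= _; rewrite andbF.
Qed.

Lemma fcut_recolor_cut e V f u :
  u \in V -> fcut e (V :\ u) f ->
  forest e (u |: cut_part (V :\ u) f) -> fcut e V (recolor f u None).
Proof.
move=> uV [hf hE _] hS; split.
- move=> b'; have [x] := hf b'; rewrite !inE => /andP[xu xV] fx.
  by exists x => //; rewrite /recolor (negPf xu).
- move=> x y xV yV exy; rewrite /recolor.
  case: (eqVneq x u) => [//|xu]; case: (eqVneq y u) => [_|yu].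
    by rewrite compatC.
  by apply: hE; rewrite ?inE ?xu ?yu.
- congr (forest e _): hS; apply/setP => x; rewrite !inE /recolor.
  by case: eqP => [->|//]; rewrite uV.
Qed.

(** [W] becomes one side; the strict inequality on cardinals guarantees a vertex for the other
    side. *)
Lemma fcut_of_sets e V W S :
  symmetric e -> S \subset V -> W \subset V -> [disjoint W & S] -> W != set0 ->
  (forall x y, x \in W -> y \in V -> e x y -> y \in W :|: S) ->
  #|W| + #|S| < #|V| -> forest e S -> exists f, fcut e V f.
Proof.
move=> sym sS sW dWS /set0Pn[w wW] hW hc hS.
exists (fun x => if x \in S then None else Some (x \in W)); split.
- case; first by exists w; rewrite ?(subsetP sW) ?(disjointFr dWS) // wW.
  have /subsetPn[y yV] : ~~ (V \subset W :|: S).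
    apply/negP => /subset_leq_card; rewrite cardsU; lia.
  by rewrite inE negb_or => /andP[/negPf yW /negPf yS]; exists y; rewrite ?yS ?yW.
- move=> x y xV yV exy; case: ifP => // xS; case: ifP => [|yS]; first by [].
  have eyx : e y x by rewrite sym.
  have := hW x y ^~ yV ^~ exy; have := hW y x ^~ xV ^~ eyx.
  rewrite !inE xS yS !orbF /=.
  by case: (x \in W); case: (y \in W) => // h1 h2; rewrite ?h1 ?h2.
- congr (forest e _): hS; apply/setP => x; rewrite !inE.
  case: ifP => [xS|]; last by rewrite andbF.
  by rewrite (subsetP sS).
Qed.

(** * Edge counts under deletion of a vertex and addition of an edge *)

Lemma arcsD1 e V u : symmetric e -> irreflexive e -> u \in V ->
  arcs e V = arcs e (V :\ u) + 2 * #|nbr e V u|.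
Proof.
move=> sym irr uV; rewrite /arcs (big_setD1 u) //=.
have nbrE x : #|nbr e V x| = e x u + #|nbr e (V :\ u) x|.
  rewrite (cardsD1 u) in_nbr uV /=; congr (_ + _); apply: eq_card => y.
  by rewrite !inE andbA.
under eq_bigr do rewrite nbrE.
rewrite big_split /=.
have -> : \sum_(x in V :\ u) e x u = #|nbr e V u|.
  rewrite -big_mkcondr /= sum1_card; apply: eq_card => x.
  rewrite unfold_in /= !inE [in RHS]sym; case: (eqVneq x u) => [->|_] //=.
  by rewrite irr andbF.
by lia.
Qed.

(** Only the degrees of [a] and [b] can grow, each by at most 1. Equality may fail: the edge may be
    present already, be degenerate, or leave [V]. *)
Lemma arcs_add_edge a b e V : arcs (add_edge a b e) V <= arcs e V + 2.
Proof.
have le1 c : \sum_(x in V) (x == c) <= 1.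
  rewrite -big_mkcondr sum1_card -(cards1 c) subset_leq_card //.
  by apply/subsetP => x; rewrite unfold_in /= inE => /andP[_].
apply: leq_trans (_ : arcs e V + (\sum_(x in V) (x == a) + \sum_(x in V) (x == b)) <= _).
  rewrite /arcs -!big_split /=; apply: leq_sum => x _.
  apply: leq_trans (_ : #|nbr e V x :|: (([set y | (x == a) && (y == b)]) :|:
     [set y | (x == b) && (y == a)])| <= _).
    apply: subset_leq_card; apply/subsetP => y; rewrite !inE /add_edge.
    by case: (y \in V) => //=; case: (e x y) => //=; case/andP.
  have c1 (p q : T) : #|[set y | (x == p) && (y == q)]| <= (x == p).
    case: eqP => _ /=; last by rewrite leqn0 cards_eq0; apply/eqP/setP=> y; rewrite !inE.
    by rewrite -(cards1 q); apply: eq_leq; apply: eq_card => y; rewrite !inE.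
  have /leq_of_leqif := leq_card_setU (nbr e V x) ([set y | (x == a) && (y == b)] :|:
     [set y | (x == b) && (y == a)]).
  have /leq_of_leqif := leq_card_setU [set y | (x == a) && (y == b)] [set y | (x == b) && (y == a)].
  by have := c1 a b; have := c1 b a; lia.
by have := le1 a; have := le1 b; lia.
Qed.


(** * Triangles, and listing the elements of small sets *)

Lemma forest_no_triangle e S x y z :
  symmetric e -> irreflexive e -> forest e S ->
  x \in S -> y \in S -> z \in S -> e x y -> e y z -> e x z -> False.
Proof.
move=> sym irr /forestP h xS yS zS exy eyz exz.
have ne p q : e p q -> p != q by apply: contraTneq => ->; rewrite irr.
have [|| w] := h [set x; y; z].
- by apply/subsetP => w; rewrite !inE => /orP[/orP[]|] /eqP->.
- by apply/set0Pn; exists x; rewrite !inE eqxx.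
rewrite !inE leqNgt => wX /negP[]; apply/card_gt1P.
case/orP: wX => [/orP[]|] /eqP->.
- by exists y, z; rewrite !inE !eqxx !orbT; split=> //; apply: ne.
- by exists x, z; rewrite !inE !eqxx !orbT sym; split=> //; apply: ne.
- exists x, y; rewrite !inE !eqxx !orbT ![e z _]sym; split=> //; exact: ne.
Qed.

Lemma card_le1_sub1 (A : {set T}) z : A \subset [set z] -> #|A| <= 1.
Proof. by move=> /subset_leq_card; rewrite cards1. Qed.

Lemma seq_fills_set (A : {set T}) (s : seq T) :
  uniq s -> {subset s <= A} -> #|A| <= size s -> A =i s.
Proof.
move=> us sA cA.
have /eqP <- : [set x in s] == A.
  rewrite eqEcard cardsE (card_uniqP us) cA andbT.
  by apply/subsetP => x; rewrite inE; apply: sA.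
by move=> x; rewrite inE.
Qed.

Lemma seq_fills_set_but1 (A : {set T}) (s : seq T) :
  uniq s -> {subset s <= A} -> #|A| = (size s).+1 ->
  exists2 x, uniq (rcons s x) & A =i rcons s x.
Proof.
move=> us sA cA.
have /subsetPn[x xA] : ~~ (A \subset [set x in s]).
  by apply/negP => /subset_leq_card; rewrite cardsE (card_uniqP us); lia.
rewrite inE => xs; exists x; first by rewrite rcons_uniq xs.
apply: seq_fills_set; rewrite ?rcons_uniq ?xs ?size_rcons ?cA //.
by move=> y; rewrite mem_rcons inE => /orP[/eqP->|/sA].
Qed.

(** * A counterexample of minimum order: first properties and minimum degree *)

Section MinimalCounterexample.

Variables (e : rel T) (V : {set T}).
Hypothesis e_sym : symmetric e.
Hypothesis e_irr : irreflexive e.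
(** As [arcs] counts every edge twice, this is the bound of the theorem multiplied by 10. *)
Hypothesis few_arcs : 5 * arcs e V + 36 < 22 * #|V|.
Hypothesis no_fcut : forall f, ~ fcut e V f.
(** Minimality ranges over all relations [e'], not only over [e], so that edges may be added after
    deleting vertices. *)
Hypothesis smaller_fcut : forall e' (W : {set T}), #|W| < #|V| ->
  symmetric e' -> irreflexive e' -> 5 * arcs e' W + 36 < 22 * #|W| ->
  exists f, fcut e' W f.

Local Notation N := (nbr e V).

Lemma nbr_sub u : {subset N u <= V}.
Proof. by move=> y; rewrite in_nbr => /andP[]. Qed.

Lemma nbr_subD1 u : {subset N u <= V :\ u}.
Proof.
move=> y; rewrite !inE => /andP[-> euy]; rewrite andbT.
by apply: contraTneq euy => ->; rewrite e_irr.
Qed.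

(** Without a neighbour of colour [Some b], [u] could join the opposite side. *)
Lemma fcutD1_sides u f b : u \in V -> fcut e (V :\ u) f ->
  exists2 y, y \in N u & f y = Some b.
Proof.
move=> uV hf; case: (boolP [exists y in N u, f y == Some b]).
  by case/exists_inP => y yN /eqP; exists y.
rewrite negb_exists => /forallP h; case: (no_fcut (f := recolor f u (Some (~~ b)))).
apply: fcut_recolor_side => // y yV euy; have := h y.
rewrite in_nbr yV euy /=; case: (f y) => [b'|//]; by case: b b' {h} => [] [].
Qed.

Lemma fcutD1_cut u f : u \in V -> fcut e (V :\ u) f ->
  ~~ forest e (u |: cut_part (V :\ u) f).
Proof.
move=> uV hf; apply/negP => h; exact: no_fcut (fcut_recolor_cut uV hf h).
Qed.

Lemma fcutD1_nbr_cut u f : u \in V -> fcut e (V :\ u) f ->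
  1 < #|nbr e (cut_part (V :\ u) f) u|.
Proof.
move=> uV hf; rewrite ltnNge; apply: contra (fcutD1_cut uV hf) => h.
by apply: forestU1 => //; case: hf.
Qed.

(** Deleting [u] lowers [5 * arcs] by at least 30, more than the 22 that the bound loses, so the
    rest has a forest cut. Both of its sides meet the neighbourhood of [u], in nonadjacent
    vertices. *)
Lemma nbr_not_clique u : u \in V -> 2 < #|N u| ->
  exists y z, [/\ y \in N u, z \in N u, y != z & ~~ e y z].
Proof.
move=> uV du; have VE := cardsD1 u V; rewrite uV in VE.
have := arcsD1 e_sym e_irr uV => aE.
have [f hf] : exists f, fcut e (V :\ u) f by apply: smaller_fcut => //; lia.
have [y yN fy] := fcutD1_sides true uV hf.
have [z zN fz] := fcutD1_sides false uV hf.
exists y, z; split=> //; first by apply/eqP => yz; rewrite -yz fy in fz.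
apply/negP => eyz; case: hf => _ /(_ y z) h _.
by move: h; rewrite !(nbr_subD1 (u := u)) // fy fz => /(_ isT isT eyz).
Qed.

(** Otherwise the neighbourhood would be a forest cut isolating [u]. *)
Lemma nbr_not_forest u : u \in V -> #|N u|.+1 < #|V| -> ~~ forest e (N u).
Proof.
move=> uV du; apply/negP => fN.
suff [f] : exists f, fcut e V f by apply: no_fcut.
apply: (@fcut_of_sets e V [set u] (N u)) => //.
- by apply/subsetP => y; apply: nbr_sub.
- by rewrite sub1set.
- by rewrite disjoints1 in_nbr e_irr andbF.
- by apply/set0Pn; exists u; rewrite inE.
- by move=> x y; rewrite inE => /eqP-> yV euy; rewrite !inE yV euy orbT.
by rewrite cards1.
Qed.

Lemma not_complete : exists x y, [/\ x \in V, y \in V, x != y & ~~ e x y].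
Proof.
case: (boolP [exists x in V, exists y in V, (x != y) && ~~ e x y]).
  by case/exists_inP => x xV /exists_inP[y yV /andP[]]; exists x, y.
move=> h; exfalso.
have cN x : x \in V -> #|N x| = #|V|.-1.
  move=> xV; rewrite (cardsD1 x V) xV /=; apply: eq_card => y.
  rewrite !inE andbC; case yV: (y \in V); rewrite ?andbF // !andbT.
  apply/idP/idP => [exy|yx]; first by apply: contraTneq exy => ->; rewrite e_irr.
  apply: contraNT h => exy; apply/exists_inP; exists x => //.
  by apply/exists_inP; exists y => //; rewrite eq_sym yx.
move: few_arcs; rewrite /arcs (eq_bigr _ cN) sum_nat_const.
(* For a complete graph of order n the bound reads (5n - 12)(n - 3) < 0, which no natural number
   satisfies. *)
have [|] := leqP 4 #|V|; first by nia.
by case: #|V| => [|[|[|[|]]]].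
Qed.

Lemma min_degree u : u \in V -> 3 < #|N u|.
Proof.
move=> uV; rewrite ltnNge; apply/negP => du.
(* With at most four vertices, two nonadjacent ones are separated by the at most two others.
   Otherwise [nbr_not_forest] applies, and a cycle among at most three neighbours is a triangle
   filling the neighbourhood, contrary to [nbr_not_clique]. *)
have [V4|V5] := leqP #|V| 4.
  have [x [y [xV yV xy exy]]] := not_complete.
  have c2 : #|V| = (#|V :\ x :\ y|).+2.
    by rewrite (cardsD1 x) xV (cardsD1 y (V :\ x)) !inE eq_sym xy yV.
  suff [f] : exists f, fcut e V f by apply: no_fcut.
  apply: (@fcut_of_sets e V [set x] (V :\ x :\ y)) => //.
  - by apply/subsetP => z; rewrite !inE => /and3P[].
  - by rewrite sub1set.
  - by rewrite disjoints1 !inE eqxx andbF.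
  - by apply/set0Pn; exists x; rewrite inE.
  - move=> p q; rewrite inE => /eqP-> qV exq; rewrite !inE qV andbT.
    by case: (eqVneq q x) => //= _; rewrite andbT; apply: contraTneq exq => ->.
  - by rewrite cards1; lia.
  by apply: forest_card2 => //; lia.
have [|X [sX /set0Pn[x0 x0X] hX]] := forestPn (nbr_not_forest uV _); first lia.
have cX x : x \in X -> #|nbr e X x| < #|X|.
  move=> xX; rewrite (cardsD1 x X) xX ltnS; apply: subset_leq_card.
  apply/subsetP => y; rewrite !inE => /andP[-> exy]; rewrite andbT.
  by apply: contraTneq exy => ->; rewrite e_irr.
have XN : X = N u.
  by apply/eqP; rewrite eqEcard sX; have := cX _ x0X; have := hX _ x0X; lia.
have [|y [z [yN zN yz /negP[]]]] := nbr_not_clique uV.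
  by rewrite -XN; have := cX _ x0X; have := hX _ x0X; lia.
have /eqP NE : nbr e X y == X :\ y.
  rewrite -XN in yN; rewrite eqEcard; apply/andP; split.
    apply/subsetP => w; rewrite !inE => /andP[-> exy]; rewrite andbT.
    by apply: contraTneq exy => ->; rewrite e_irr.
  by have := hX _ yN; have := subset_leq_card sX; rewrite (cardsD1 y X) yN; lia.
have : z \in X :\ y by rewrite !inE eq_sym yz XN.
by rewrite -NE in_nbr => /andP[].
Qed.

(** Minimum degree 4 turns the edge bound into 20n + 36 < 22n. This ensures that the closed
    neighbourhood of a vertex of degree 4 or 5 is not all of [V]. *)
Lemma large_order : 18 < #|V|.
Proof.
have : \sum_(x in V) 4 <= arcs e V by apply: leq_sum => x /min_degree.
by rewrite sum_nat_const; lia.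
Qed.


(** * Vertices of degree 4 *)

(* Deleting [u] and adding the missing diagonal [ac] of its neighbourhood,
   a forest cut of the smaller graph can only separate [b] from [d] by means of
   [a] and [c]; then [u] subdivides the edge [ac] of the forest. *)
Lemma nbr4_no_C4_diag u a b c d :
  u \in V -> uniq [:: a; b; c; d] -> N u =i [:: a; b; c; d] ->
  e a b -> e b c -> e c d -> e d a -> ~~ e a c -> False.
Proof.
move=> uV us NE eab ebc ecd eda eac.
have cN : #|N u| = 4 by rewrite (eq_card NE) (card_uniqP us).
have VE := cardsD1 u V; rewrite uV in VE.
have aE := arcsD1 e_sym e_irr uV.
have ac : a != c by case/and4P: us; rewrite !inE !negb_or => /and3P[].
(* [arcs] drops by 8 and regains at most 2; the net loss of 6 contributes 30, against the 22 lost by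
   the bound. *)
have [f hf] : exists f, fcut (add_edge a c e) (V :\ u) f.
  apply: smaller_fcut.
  - by lia.
  - exact: add_edge_sym.
  - exact: add_edge_irr.
  - by have := arcs_add_edge a c e (V :\ u); lia.
have hf' : fcut e (V :\ u) f := fcut_sub (in2W (@sub_add_edge a c e)) hf.
case: (hf) => _ hE fS.
have inN x : x \in [:: a; b; c; d] -> x \in V :\ u.
  by rewrite -NE; apply: nbr_subD1.
have E x y : x \in [:: a; b; c; d] -> y \in [:: a; b; c; d] ->
    add_edge a c e x y -> compat (f x) (f y).
  by move=> /inN xN /inN yN; apply: hE.
have col b' : Some b' \in [:: f a; f b; f c; f d].
  have [y] := fcutD1_sides b' uV hf'; rewrite NE => yN <-.
  exact: (map_f f yN).
have [fa fc fb fd] : [/\ f a = None, f c = None, f b <> None & f d <> None].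
  move: (E a b) (E b c) (E c d) (E d a) (E a c) (col true) (col false).
  rewrite (add_edge_new e ac) !sub_add_edge // !inE !eqxx !orbT.
  move=> /(_ isT isT isT) + /(_ isT isT isT) + /(_ isT isT isT)
    + /(_ isT isT isT) + /(_ isT isT isT).
  by case: (f a) (f b) (f c) (f d) => [[]|] [[]|] [[]|] [[]|].
have neu x : x \in [:: a; b; c; d] -> x != u.
  by move=> /inN; rewrite !inE => /andP[].
case/negP: (fcutD1_cut uV hf'); apply: (forest_subdivide (a := a) (c := c)) => //.
- by apply: neu; rewrite inE eqxx.
- by apply: neu; rewrite !inE eqxx !orbT.
apply/subsetP => y; rewrite !inE => /andP[/andP[/andP[yu yV] /eqP fy] euy].
have : y \in N u by rewrite in_nbr yV.
rewrite NE !inE; case/or4P => /eqP yE; rewrite yE ?eqxx ?orbT //.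
  by rewrite -yE fy in fb.
by rewrite -yE fy in fd.
Qed.

(** One diagonal is missing, as the neighbourhood is not a clique; rotating the cycle covers the
    case where it is [bd]. *)
Lemma nbr4_no_C4 u a b c d :
  u \in V -> uniq [:: a; b; c; d] -> N u =i [:: a; b; c; d] ->
  e a b -> e b c -> e c d -> e d a -> False.
Proof.
move=> uV us NE eab ebc ecd eda.
have [|eac] := boolP (e a c); last exact: (nbr4_no_C4_diag uV us NE).
have [ebd eac|ebd _] := boolP (e b d); last first.
  apply: (@nbr4_no_C4_diag u b c d a) => //.
    by rewrite -(rot_uniq 1) in us.
  by move=> x; rewrite NE -(mem_rot 1).
have [|y [z []]] := nbr_not_clique uV.
  by rewrite (eq_card NE) (card_uniqP us).
rewrite !NE !inE => /or4P[] /eqP-> /or4P[] /eqP->; rewrite ?eqxx // => _;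
  by rewrite ?eab ?ebc ?ecd ?eda ?eac ?ebd // e_sym ?eab ?ebc ?ecd ?eda ?eac ?ebd.
Qed.

(* Replacing [u] and [v] by the edges [bd] and [dx] turns [b], [c], [d] into a
   triangle: [u] goes to its side, and [v] can only be stuck if [x] lies on the
   other side, which forces [d] into the cut. *)
Lemma deg4_pair_attached u v b c d x :
  u \in V -> v \in V -> uniq [:: v; b; c; d] -> uniq [:: u; b; c; x] ->
  N u =i [:: v; b; c; d] -> N v =i [:: u; b; c; x] -> e b c -> e c d -> False.
Proof.
move=> uV vV usu usv NuE NvE ebc ecd.
have inN y : y \in [:: v; b; c; d] -> y \in V :\ u.
  by rewrite -NuE; apply: nbr_subD1.
have inN' y : y \in [:: u; b; c; x] -> y \in V :\ v.
  by rewrite -NvE; apply: nbr_subD1.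
have uV' : u \in V :\ v by apply: inN'; rewrite inE eqxx.
have inW y : y \in [:: b; c; d; x] -> y \in V :\ v :\ u.
  move: usu usv (inN y) (inN' y); rewrite /= !inE !negb_or.
  case/and4P => /and3P[vb vc vd] _ _ _ /and4P[/and3P[ub uc ux] _ _ _].
  move=> h h'; case/or4P => /eqP yE; move: h h'; rewrite yE ?eqxx ?orbT.
  - by move=> /(_ isT) /andP[-> _] /(_ isT).
  - by move=> /(_ isT) /andP[-> _] /(_ isT).
  - by move=> /(_ isT) /andP[-> ->] _; rewrite eq_sym vd.
  - by move=> _ /(_ isT) ->; rewrite eq_sym ux.
have cu : #|N u| = 4 by rewrite (eq_card NuE) (card_uniqP usu).
have cv : #|N v| = 4 by rewrite (eq_card NvE) (card_uniqP usv).
have cu' : #|nbr e (V :\ v) u| = 3.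
  have := cardsD1 v (N u); rewrite NuE inE eqxx cu => -[->].
  by apply: eq_card => y; rewrite !inE andbA.
have VE := cardsD1 v V; rewrite vV in VE.
have VE' := cardsD1 u (V :\ v); rewrite uV' in VE'.
have aE := arcsD1 e_sym e_irr vV.
have aE' := arcsD1 e_sym e_irr uV'.
set e1 := add_edge d x e; set e2 := add_edge b d e1.
have sym1 : symmetric e1 by apply: add_edge_sym.
have irr1 : irreflexive e1 by apply: add_edge_irr.
have sym2 : symmetric e2 by apply: add_edge_sym.
have irr2 : irreflexive e2 by apply: add_edge_irr.
(* [arcs] drops by 8 for [v], by 6 for [u], and regains at most 4; the net loss of 10 contributes
   50, against the 44 lost by the bound. *)
have [f hf] : exists f, fcut e2 (V :\ v :\ u) f.
  apply: smaller_fcut => //; first by lia.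
  have := arcs_add_edge b d e1 (V :\ v :\ u).
  by have := arcs_add_edge d x e (V :\ v :\ u); rewrite -/e1 -/e2; lia.
have see : subrel e e2 by move=> y z h; do 2!apply: sub_add_edge.
have hf' : fcut e (V :\ v :\ u) f := fcut_sub (in2W see) hf.
case: (hf) => _ hE fS.
have bd : b != d by case/and4P: usu => _; rewrite !inE !negb_or => /andP[].
have e2bd : e2 b d by apply: add_edge_new.
have bW : b \in V :\ v :\ u by apply: inW; rewrite !inE eqxx.
have cW : c \in V :\ v :\ u by apply: inW; rewrite !inE eqxx orbT.
have dW : d \in V :\ v :\ u by apply: inW; rewrite !inE eqxx !orbT.
have xW : x \in V :\ v :\ u by apply: inW; rewrite !inE eqxx !orbT.
have Ebc := hE _ _ bW cW (see _ _ ebc).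
have Ecd := hE _ _ cW dW (see _ _ ecd).
have Ebd := hE _ _ bW dW e2bd.
have Edx : compat (f d) (f x).
  case: (eqVneq d x) => [->|dx]; first by case: (f x) => [[]|].
  by apply: hE => //; apply: sub_add_edge; apply: add_edge_new.
have nN : ~~ [&& f b == None, f c == None & f d == None].
  apply/negP => /and3P[fb fc fd].
  have inS y : y \in V :\ v :\ u -> f y == None -> y \in cut_part (V :\ v :\ u) f.
    by move=> yW fy; rewrite inE yW.
  apply: (forest_no_triangle sym2 irr2 fS (inS _ bW fb) (inS _ cW fc) (inS _ dW fd));
    by [apply: see | ].
(* The triangle is not entirely in the cut, and its vertices outside the cut all lie on one side
   [s]. *)
have [s [sb sc sd]] : exists s, [/\ f b <> Some (~~ s), f c <> Some (~~ s)
    & f d <> Some (~~ s)].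
  case: (f b) (f c) (f d) Ebc Ecd Ebd nN {Edx} => [[]|] [[]|] [[]|] //= _ _ _ _;
    by [exists true | exists false].
have hg : fcut e (V :\ v) (recolor f u (Some s)).
  apply: fcut_recolor_side => // y; rewrite !inE => /andP[yv yV] euy.
  have : y \in N u by rewrite in_nbr yV.
  rewrite NuE !inE (negPf yv) /= => /or3P[] /eqP->.
  - by case: (f b) sb => [b'|//]; case: s b' {sc sd} => [] [].
  - by case: (f c) sc => [b'|//]; case: s b' {sb sd} => [] [].
  - by case: (f d) sd => [b'|//]; case: s b' {sb sc} => [] [].
have gE y : y \in V :\ v :\ u -> recolor f u (Some s) y = f y.
  by rewrite /recolor !inE => /andP[/negPf-> _].
have fx : f x = Some (~~ s).
  have [y] := fcutD1_sides (~~ s) vV hg; rewrite NvE !inE => /or4P[] /eqP->.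
  - by rewrite /recolor eqxx; case: s {sb sc sd hg gE}.
  - by rewrite gE.
  - by rewrite gE.
  - by rewrite gE.
have fd : f d = None.
  by move: Edx; rewrite fx; case: (f d) sd => [b'|//]; case: s b' {sb sc fx hg gE} => [] [].
(* Two neighbours of [v] must be in the cut. As [u] and [x] lie on sides, they are [b] and [c],
   which together with [d] would put the whole triangle into the cut. *)
have /card_gt1P[y [z [yS zS yz]]] := fcutD1_nbr_cut vV hg.
have inbc w : w \in nbr e (cut_part (V :\ v) (recolor f u (Some s))) v ->
    (w \in [:: b; c]) && (f w == None).
  rewrite !inE => /andP[/andP[/andP[wv wV] gw] evw].
  have : w \in N v by rewrite in_nbr wV.
  rewrite NvE !inE => /or4P[] /eqP wE; move: gw; rewrite wE.
  - by rewrite /recolor eqxx.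
  - by rewrite gE // => ->; rewrite eqxx.
  - by rewrite gE // => ->; rewrite eqxx orbT.
  - by rewrite gE // fx.
have := inbc z zS; have := inbc y yS; rewrite !inE.
move=> /andP[/orP[] /eqP yE fy] /andP[/orP[] /eqP zE fz]; move: yz nN fy fz;
  by rewrite fd yE zE ?eqxx // => _ + fy fz; rewrite fy fz.
Qed.

(** If [b] or [c] is adjacent to [d] or [x], symmetry reduces to [deg4_pair_attached]. Otherwise the
    set of [b], [c], [d], [x] has at most the edges [bc] and [dx], hence is a forest, and it
    separates [u] and [v] from the rest. *)
Lemma deg4_pair u v b c d x :
  u \in V -> v \in V -> uniq [:: v; b; c; d] -> uniq [:: u; b; c; x] ->
  N u =i [:: v; b; c; d] -> N v =i [:: u; b; c; x] -> e b c -> False.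
Proof.
move=> uV vV usu usv NuE NvE ebc.
have swap (w : T) t (A : {set T}) : uniq [:: w; b; c; t] -> A =i [:: w; b; c; t] ->
    uniq [:: w; c; b; t] /\ A =i [:: w; c; b; t].
  have pE : perm_eq [:: w; b; c; t] [:: w; c; b; t].
    by rewrite perm_cons (perm_catCA [:: b] [:: c] [:: t]).
  move=> us AE; split; first by rewrite -(perm_uniq pE).
  by move=> y; rewrite AE (perm_mem pE).
have [usu' NuE'] := swap _ _ _ usu NuE; have [usv' NvE'] := swap _ _ _ usv NvE.
have ecb : e c b by rewrite e_sym.
have [ecd|ecd] := boolP (e c d).
  exact: (deg4_pair_attached uV vV usu usv NuE NvE).
have [ebd|ebd] := boolP (e b d).
  exact: (deg4_pair_attached uV vV usu' usv' NuE' NvE').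
have [ecx|ecx] := boolP (e c x).
  exact: (deg4_pair_attached vV uV usv usu NvE NuE).
have [ebx|ebx] := boolP (e b x).
  exact: (deg4_pair_attached vV uV usv' usu' NvE' NuE').
suff [f] : exists f, fcut e V f by apply: no_fcut.
have sNu y : y \in [:: v; b; c; d] -> y \in V by rewrite -NuE; apply: nbr_sub.
have sNv y : y \in [:: u; b; c; x] -> y \in V by rewrite -NvE; apply: nbr_sub.
(* Inserting the vertices one at a time suits [forestU1]. The cardinal is only bounded by 4, since
   [d] and [x] may coincide. *)
pose S := x |: (d |: (c |: (b |: set0))).
have cS : #|S| <= 4.
  by rewrite /S !cardsU1 cards0; do 4!case: (_ \notin _).
apply: (@fcut_of_sets e V [set u; v] S) => //.
- apply/subsetP => y; rewrite !inE orbF => /or4P[] /eqP->.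
  + by apply: sNv; rewrite !inE eqxx !orbT.
  + by apply: sNu; rewrite !inE eqxx !orbT.
  + by apply: sNu; rewrite !inE eqxx !orbT.
  + by apply: sNu; rewrite !inE eqxx !orbT.
- by apply/subsetP => y; rewrite !inE => /orP[] /eqP->.
- have uN : u \notin N u by rewrite in_nbr e_irr andbF.
  have vN : v \notin N v by rewrite in_nbr e_irr andbF.
  move: usu usv uN vN; rewrite NuE NvE /= !inE !negb_or.
  case/and4P => /and3P[vb vc vd] _ _ _ /and4P[/and3P[ub uc ux] _ _ _].
  case/and4P => uv _ _ ud /and4P[_ _ _ vx].
  rewrite -setI_eq0; apply/eqP/setP => y; rewrite !inE orbF.
  apply/negP => /andP[/orP[] /eqP->];
  by rewrite ?(negPf ux) ?(negPf ud) ?(negPf uc) ?(negPf ub) ?(negPf vx) ?(negPf vd)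
    ?(negPf vc) ?(negPf vb).
- by apply/set0Pn; exists u; rewrite !inE eqxx.
- move=> y z; rewrite !inE => /orP[] /eqP-> zV eyz.
    have : z \in N u by rewrite in_nbr zV.
    by rewrite NuE !inE; do 4!case: (z == _); rewrite ?orbT.
  have : z \in N v by rewrite in_nbr zV.
  by rewrite NvE !inE; do 4!case: (z == _); rewrite ?orbT.
- have := large_order; rewrite cards2; lia.
- apply: forestU1 => //; first apply: forestU1 => //; first apply: forestU1 => //;
    first apply: forestU1 => //; first exact: forest0.
  + by rewrite (leq_trans (subset_leq_card (_ : _ \subset set0))) ?cards0 //;
      apply/subsetP => y; rewrite !inE.
  + apply: (@card_le1_sub1 _ b); apply/subsetP => y; rewrite !inE orbF.
    by case/andP.
  + apply: (@card_le1_sub1 _ b); apply/subsetP => y; rewrite !inE orbF.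
    by case/andP => /orP[] /eqP->; rewrite e_sym ?(negPf ecd) ?(negPf ebd).
  + apply: (@card_le1_sub1 _ d); apply/subsetP => y; rewrite !inE orbF.
    by case/andP => /or3P[] /eqP->; rewrite ?eqxx // e_sym ?(negPf ecx) ?(negPf ebx).
Qed.

Lemma deg4_nbr_triangle u : u \in V -> #|N u| = 4 ->
  exists a b c d, [/\ uniq [:: a; b; c; d], N u =i [:: a; b; c; d],
                      e a b, e b c & e a c].
Proof.
move=> uV cu.
have [|X [sX /set0Pn[a aX] hX]] := forestPn (nbr_not_forest uV _).
  by have := large_order; lia.
have ne p q : e p q -> p != q by apply: contraTneq => ->; rewrite e_irr.
have XN y : y \in X -> y \in N u by apply: (subsetP sX).
have /card_gt1P[b [c []]] := hX a aX.
rewrite !in_nbr => /andP[bX eab] /andP[cX eac] bc.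
have us3 : uniq [:: a; b; c] by rewrite /= !inE !negb_or bc !ne.
have s3 : {subset [:: a; b; c] <= N u}.
  by apply/allP; rewrite /= !XN.
have [ebc|ebc] := boolP (e b c).
  have [|d us NE] := seq_fills_set_but1 us3 s3; first by rewrite cu.
  by exists a, b, c, d.
exfalso.
(* With [bc] missing, the second neighbour of [b] in [X] is the fourth neighbour of [u]. The second
   neighbour of [c] in [X] can then only be [d], which closes a forbidden 4-cycle. *)
have [d dX /andP[ebd da]] : exists2 d, d \in X & e b d && (d != a).
  have /card_gt1P[y [z []]] := hX b bX; rewrite !in_nbr.
  move=> /andP[yX eby] /andP[zX ebz] yz.
  have [ya|ya] := eqVneq y a; last by exists y; rewrite ?eby.
  by exists z; rewrite // ebz -ya eq_sym.
have dc : d != c by apply: contraNneq ebc => <-.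
have us : uniq [:: a; b; d; c].
  by move: us3; rewrite /= !inE !negb_or eq_sym (ne _ _ ebd) dc
    !(eq_sym a) da => /and3P[/andP[-> ->] ->].
have NE : N u =i [:: a; b; d; c].
  apply: seq_fills_set => //; last by rewrite cu.
  by apply/allP; rewrite /= !XN.
apply: (nbr4_no_C4 uV us NE) => //; last by rewrite e_sym.
apply: contraLR (hX c cX) => edc; rewrite -leqNgt.
apply: (@card_le1_sub1 _ a); apply/subsetP => y; rewrite in_nbr => /andP[yX ecy].
have := XN y yX; rewrite NE !inE => /or4P[] /eqP yE; move: ecy; first by rewrite yE eqxx.
- by rewrite yE e_sym (negPf ebc).
- by rewrite yE e_sym (negPf edc).
- by rewrite yE e_irr.
Qed.

(** If [a] had degree 4, then [u] and [a] would share the adjacent neighbours [b] and [c] and have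
    one further neighbour each, as excluded by [deg4_pair]. *)
Lemma deg4_triangle_deg u a b c d :
  u \in V -> uniq [:: a; b; c; d] -> N u =i [:: a; b; c; d] ->
  e a b -> e b c -> e a c -> #|N a| <> 4.
Proof.
move=> uV us NE eab ebc eac ca.
have inN y : y \in [:: a; b; c; d] -> y \in V :\ u.
  by rewrite -NE; apply: nbr_subD1.
have ne y : y \in [:: a; b; c; d] -> u != y.
  by move/inN; rewrite !inE eq_sym => /andP[].
have inV y : y \in [:: a; b; c; d] -> y \in V.
  by move/inN; rewrite !inE => /andP[].
have aV : a \in V by apply: inV; rewrite inE eqxx.
have us3 : uniq [:: u; b; c].
  move: (us); rewrite /= !inE !negb_or !ne ?inE ?eqxx ?orbT //.
  by case/and4P => _ /andP[-> _].
have s3 : {subset [:: u; b; c] <= N a}.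
  apply/allP; rewrite /= !in_nbr uV eab eac !inV ?inE ?eqxx ?orbT //=.
  have : a \in N u by rewrite NE inE eqxx.
  by rewrite in_nbr e_sym => /andP[_ ->].
have [|x usx NaE] := seq_fills_set_but1 us3 s3; first by rewrite ca.
exact: (@deg4_pair u a b c d x).
Qed.

(** * Discharging *)

Definition deg4 : {set T} := [set x in V | #|N x| == 4].

(** Three neighbours of [u] form a triangle and do not have degree 4. Permuting them lets
    [deg4_triangle_deg] apply to each. *)
Lemma deg4_nbr_deg4 u : u \in deg4 -> #|N u :&: deg4| <= 1.
Proof.
rewrite inE => /andP[uV /eqP cu].
have [a [b [c [d [us NE eab ebc eac]]]]] := deg4_nbr_triangle uV cu.
apply: (@card_le1_sub1 _ d); apply/subsetP => y.
have eba : e b a by rewrite e_sym.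
have ecb : e c b by rewrite e_sym.
have eca : e c a by rewrite e_sym.
rewrite !in_setI NE [y \in deg4]inE !inE => /andP[+ /andP[_ /eqP cy]].
case/or4P => /eqP yE; rewrite yE in cy; last by rewrite yE.
- by case: (deg4_triangle_deg uV us NE).
- have pE : perm_eq [:: a; b; c; d] [:: b; a; c; d].
    by rewrite (perm_catCA [:: a] [:: b] [:: c; d]).
  case: (@deg4_triangle_deg u b a c d) => //; first by rewrite -(perm_uniq pE).
  by move=> z; rewrite NE (perm_mem pE).
- have pE : perm_eq [:: a; b; c; d] [:: c; a; b; d].
    by rewrite (perm_catCA [:: a; b] [:: c] [:: d]).
  case: (@deg4_triangle_deg u c a b d) => //; first by rewrite -(perm_uniq pE).
  by move=> z; rewrite NE (perm_mem pE).
Qed.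

(** Otherwise a vertex of a cycle in the neighbourhood would have degree 4 and two neighbours of
    degree 4. *)
Lemma deg5_nbr_deg4 w : w \in V -> #|N w| = 5 -> #|N w :&: deg4| <= 4.
Proof.
move=> wV cw; rewrite leqNgt; apply/negP => h.
have sN : N w \subset deg4.
  by apply/setIidPl/eqP; rewrite eqEcard subsetIl cw.
have [|X [sX /set0Pn[x xX] hX]] := forestPn (nbr_not_forest wV _).
  by have := large_order; lia.
have sX4 := subset_trans sX sN.
have := deg4_nbr_deg4 (subsetP sX4 x xX); rewrite leqNgt => /negP[].
apply: leq_trans (hX x xX) _; apply: subset_leq_card; apply/subsetP => y.
rewrite in_nbr in_setI => /andP[yX exy]; rewrite (subsetP sX4) // andbT.
by rewrite in_nbr exy (nbr_sub (u := w)) // (subsetP sX).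
Qed.

Lemma edges_between_deg4 :
  \sum_(u in deg4) #|N u :\: deg4| = \sum_(w in V :\: deg4) #|N w :&: deg4|.
Proof.
have sub4 : deg4 \subset V by apply/subsetP => x; rewrite inE => /andP[].
have cE (A B : {set T}) x : A = [set y in B | e x y] -> #|A| = \sum_(y in B) e x y.
  move=> ->; rewrite -big_mkcondr sum1_card; apply: eq_card => y.
  by rewrite inE unfold_in.
rewrite (eq_bigr (fun u => \sum_(w in V :\: deg4) e u w)); last first.
  by move=> u _; apply: cE; apply/setP => y; rewrite !inE andbA.
rewrite exchange_big /=; apply: eq_bigr => w _.
under eq_bigr do rewrite e_sym.
apply/esym/cE/setP => y; rewrite in_setI in_nbr [RHS]inE.
by case y4: (y \in deg4); rewrite ?andbF // (subsetP sub4) // andbT.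
Qed.

(* Discharging: every vertex of degree 4 gets 2/15 from each of its at least
   three neighbours of larger degree, and ends with at least 22/5. *)
Lemma minimal_counterexample_false : False.
Proof.
have VE : V :&: deg4 = deg4.
  by apply/setIidPr/subsetP => x; rewrite inE => /andP[].
(* Charges are multiplied by 15, so 22/5 becomes 66 and 2/15 becomes 2; here 60 + 2 * 3 = 66. *)
have lo : \sum_(u in deg4) 66 <= \sum_(u in deg4) (15 * #|N u| + 2 * #|N u :\: deg4|).
  apply: leq_sum => u u4; have := deg4_nbr_deg4 u4.
  have := cardsID deg4 (N u); move: u4; rewrite inE => /andP[_ /eqP->]; lia.
(* In degree 5 at most four neighbours are served, and 66 + 8 <= 75; in degree d >= 6 even serving
   all is affordable, as 66 + 2d <= 15d. *)
have hi : \sum_(w in V :\: deg4) (66 + 2 * #|N w :&: deg4|)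
    <= \sum_(w in V :\: deg4) 15 * #|N w|.
  apply: leq_sum => w; rewrite !inE => /andP[+ wV]; rewrite wV /= => nw.
  have := min_degree wV; have := cardsID deg4 (N w).
  have [/(deg5_nbr_deg4 wV)|] := eqVneq #|N w| 5; lia.
rewrite big_split /= -!big_distrr /= edges_between_deg4 in lo.
rewrite big_split /= -!big_distrr /= in hi.
have cV := cardsID deg4 V; rewrite VE in cV.
have := few_arcs; rewrite /arcs (big_setID deg4) /= VE.
rewrite !sum_nat_const in lo hi; lia.
Qed.

End MinimalCounterexample.

(** * Induction on the order *)

(** Only finitely many colourings exist once they are taken as finite functions, so the case
    distinction is constructive. *)
Lemma fcut_decidable e V : (exists f, fcut e V f) \/ (forall f, ~ fcut e V f).
Proof.
pose fcutb (g : {ffun T -> option bool}) :=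
  [&& [forall b, exists x in V, g x == Some b],
      [forall x in V, forall y in V, e x y ==> compat (g x) (g y)]
    & forest e (cut_part V g)].
case: (boolP [exists g, fcutb g]) => [/existsP[g /and3P[hf hE hS]] | h].
  left; exists g; split=> // [b|x y xV yV].
    by have /exists_inP[x xV /eqP gx] := forallP hf b; exists x.
  by have /forall_inP/(_ y yV)/implyP := forall_inP hE x xV.
right=> f [hf hE hS]; case/existsP: h; exists (finfun f); apply/and3P; split.
- apply/forallP => b; have [x xV fx] := hf b.
  by apply/exists_inP; exists x; rewrite ?ffunE ?fx.
- apply/forall_inP => x xV; apply/forall_inP => y yV; apply/implyP.
  by rewrite !ffunE; apply: hE.
- by congr (forest e _): hS; apply/setP => x; rewrite !inE ffunE.
Qed.

Lemma fcut_exists e V : symmetric e -> irreflexive e ->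
  5 * arcs e V + 36 < 22 * #|V| -> exists f, fcut e V f.
Proof.
have [n] := ubnP #|V|; elim: n => // n IHn in e V *.
rewrite ltnS => cV sym irr few; have [//|no] := fcut_decidable e V.
case: (minimal_counterexample_false sym irr few no) => e' W cW sym' irr'.
by apply: IHn => //; apply: leq_trans cW cV.
Qed.

(** * Return to paths, cycles and edge sets *)

Lemma fcut_forest_cut e f : symmetric e -> irreflexive e -> fcut e setT f ->
  forest_cut e (cut_part setT f).
Proof.
move=> sym irr [hf hE hS]; split.
  have inC b x : f x = Some b -> x \in ~: cut_part setT f.
    by move=> fx; rewrite !inE fx.
  have [x _ fx] := hf true; have [y _ fy] := hf false.
  exists (exist _ x (inC _ _ fx)), (exist _ y (inC _ _ fy)).
  (* Colour [Some true] persists along any path that avoids the cut. *)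
  have inv z p : path (induced e (~: cut_part setT f)) z p ->
      f (val z) = Some true -> f (val (last z p)) = Some true.
    elim: p z => //= w p IHp z /andP[ezw pw] fz; apply: IHp => //.
    have := hE _ _ (in_setT _) (in_setT _) ezw; rewrite fz.
    by have := valP w; rewrite !inE; case: (f (val w)) => // [[]].
  apply/negP => /connectP[p pP pL]; have := inv _ _ pP fx.
  by rewrite -pL /= fy.
move=> c c3 /andP[cc uc].
have /forestP h := hS.
case: c => [//|x0 c0] in c3 cc uc *; set c := x0 :: c0 in c3 cc uc *.
(* The vertices of a cycle form a test set violating 1-degeneracy: after rotating [z] to the front,
   its successor and predecessor are two distinct neighbours because the length exceeds 2. *)
have [|| _ /imsetP[z zc ->]] := h [set val z | z in c].
- by apply/subsetP => _ /imsetP[z _ ->]; apply: valP.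
- by apply/set0Pn; exists (val x0); apply: imset_f; rewrite inE eqxx.
rewrite leqNgt => /negP[].
have [i p pE] := rot_to zc.
have cp : cycle (induced e (cut_part setT f)) (z :: p) by rewrite -pE rot_cycle.
have up : uniq (z :: p) by rewrite -pE rot_uniq.
have sp : size (z :: p) = size c by rewrite -pE size_rot.
have mp w : w \in p -> w \in c.
  by move=> wp; rewrite -(mem_rot i) pE inE wp orbT.
case: p => [|y1 p] in pE cp up sp mp; first by rewrite -sp in c3.
case/lastP: p => [|p yk] in pE cp up sp mp; first by rewrite -sp in c3.
move: cp; rewrite /= rcons_path last_rcons => /andP[ezy /andP[_ eyz]].
apply/card_gt1P; exists (val y1), (val yk); split.
- by rewrite in_nbr imset_f ?mp ?inE ?eqxx.
- rewrite in_nbr imset_f ?mp ?inE ?mem_rcons ?inE ?eqxx ?orbT //=.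
  by rewrite sym.
- move: up => /= /andP[_ /andP[]]; rewrite mem_rcons inE negb_or => /andP[+ _ _].
  by apply: contraNneq => /val_inj->.
Qed.

Lemma arcs_le_edges e : irreflexive e -> arcs e setT <= 2 * #|edges e|.
Proof.
move=> irr; pose D := [set p : T * T | e p.1 p.2].
have -> : arcs e setT = #|D|.
  rewrite -sum1_card /arcs.
  under eq_bigr do rewrite -sum1_card.
  rewrite pair_big_dep /=; apply: eq_bigl => -[x y]; by rewrite !inE.
have -> : edges e = [set [set p.1; p.2] | p in D].
  by apply/setP => A; apply/imsetP/imsetP => -[p pD ->]; exists p; rewrite ?inE in pD *.
(* Group the ordered pairs by their underlying edge: the fibre over an edge [ab] contains at most
   [(a, b)] and [(b, a)]. *)
rewrite -sum1_card (partition_big_imset (fun p : T * T => [set p.1; p.2])) /=.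
rewrite mulnC -sum_nat_const; apply: leq_sum => A /imsetP[[a b] _ ->] /=.
apply: (@leq_trans #|[set (a, b); (b, a)]|); last by rewrite cards2; case: eqP.
rewrite sum1_card; apply: subset_leq_card; apply/subsetP => -[x y].
rewrite unfold_in /= !inE /= => /andP[exy /eqP xyE].
have xab : x \in [set a; b] by rewrite -xyE !inE eqxx.
have yab : y \in [set a; b] by rewrite -xyE !inE eqxx orbT.
have axy : a \in [set x; y] by rewrite xyE !inE eqxx.
have bxy : b \in [set x; y] by rewrite xyE !inE eqxx orbT.
move: xab yab axy bxy exy; rewrite !inE !xpair_eqE.
by case/orP => /eqP-> /orP[] /eqP->; rewrite ?irr ?eqxx ?orbT.
Qed.

End ForestCuts.

Theorem theorem2 (T : finType) (e : rel T)
  (e_sym : symmetric e) (e_irr : irreflexive e)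
  (few_edges : (#|edges e|%:R < 11%:R / 5%:R * #|T|%:R - 18%:R / 5%:R :> rat)%R) :
  exists S : {set T}, forest_cut e S.
Proof.
have few : 5 * #|edges e| + 18 < 11 * #|T|.
  by rewrite -(ltr_nat rat) natrD !natrM; lra.
have [|f hf] := @fcut_exists T e setT e_sym e_irr.
  by rewrite cardsT; have := arcs_le_edges e_irr; lia.
by exists (cut_part setT f); apply: fcut_forest_cut.
Qed.
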